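(* Let $M$ be a closed manifold of dimension $d\ge1$ with a fixed Riemannian metric $g_0$, and let $\Lambda\ge0$. For $g_1,g_2\in\operatorname{Met}(M)$ let $\operatorname{dist}^{\mathrm{WE}}(g_1,g_2)$ denote the geodesic distance of the Wasserstein--Ebin metric. Then $$\operatorname{dist}^{\mathrm{WFR}}(\operatorname{vol}(g_1),\operatorname{vol}(g_2))\le\operatorname{dist}^{\mathrm{WE}}(g_1,g_2)\le\frac{\sqrt{d\Lambda}}{2}\operatorname{dist}^{\mathrm{E}}(g_1,g_2),$$ where $\operatorname{dist}^{\mathrm{E}}$ denotes the geodesic distance of the Ebin metric on the space of Riemannian metrics and $\operatorname{dist}^{\mathrm{WFR}}$ denotes the geodesic distance of the Wasserstein--Fisher--Rao metric on the space of smooth densities.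
   Context: $\operatorname{Met}(M)$ is the space of smooth Riemannian metrics on $M$, with $T_g\operatorname{Met}(M)=\Gamma^\infty(\operatorname{Sym}^2T^*M)$; $\operatorname{Dens}(M)$ is the space of smooth positive densities; $\operatorname{vol}(g)$ is the volume density of $g$; $\mathcal L$ is the Lie derivative. Ebin metric: $G^{\mathrm E}_g(h,k)=\int_M\operatorname{tr}(g^{-1}hg^{-1}k)\operatorname{vol}(g)$. Wasserstein--Ebin metric on $\operatorname{Met}(M)$: $$G^{\mathrm{WE}}_g(\delta g,\delta g)=\inf_{v,h}\ \int_M g_0(v,v)\operatorname{vol}(g)+\frac{d\Lambda}{4}\int_M\operatorname{tr}(g^{-1}hg^{-1}h)\operatorname{vol}(g),$$ the infimum over smooth vector fields $v$ and $h\in T_g\operatorname{Met}(M)$ with $\delta g=-\mathcal L_vg+h$. Wasserstein--Fisher--Rao metric on $\operatorname{Dens}(M)$: $$G^{\mathrm{WFR}}_\rho(\delta\rho,\delta\rho)=\inf_{v,f}\ \int_M g_0(v,v)\rho+\Lambda\int_M f^2\rho,$$ the infimum over smooth vector fields $v$ and smooth functions $f$ with $\delta\rho=-\mathcal L_v\rho+f\rho$. The geodesic distance of a metric $G$ between two points is the infimum of the lengths $\int_0^1\sqrt{G_\gamma(\dot\gamma,\dot\gamma)}\,dt$ over all (piecewise smooth) paths $\gamma$ in the respective space joining them. *)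

(* Defs.v *)
From HB Require Import structures.
From mathcomp Require Import all_boot all_order all_algebra.
From mathcomp Require Import all_classical all_reals all_analysis.

Set Implicit Arguments.
Unset Strict Implicit.
Unset Printing Implicit Defensive.

Import Order.TTheory GRing.Theory Num.Theory.
Import numFieldNormedType.Exports.

Local Open Scope classical_set_scope.
Local Open Scope ring_scope.

(* [f] is C^k on the open set [U]: all iterated directional derivatives of
   order at most [k] exist and are continuous on [U]. *)
Fixpoint Ck (R : realType) (V W : normedModType R) (k : nat) (U : set V)
    (f : V -> W) : Prop :=
  (forall x, U x -> {for x, continuous f}) /\
  if k is k'.+1 then
    forall v, (forall x, U x -> derivable f x v) /\ Ck k' U ('D_v f)
  else True.

Definition smooth_open (R : realType) (V W : normedModType R) (U : set V)
    (f : V -> W) : Prop :=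
  forall k, Ck k U f.

(* Smoothness on an arbitrary subset [A], e.g. [a, b] x U: [f] extends to a
   smooth map on an open neighbourhood of [A]. *)
Definition smooth_on (R : realType) (V W : normedModType R) (A : set V)
    (f : V -> W) : Prop :=
  exists (O : set V) (F : V -> W),
    [/\ open O, A `<=` O, smooth_open O F & forall x, A x -> f x = F x].

(* A smooth atlas on a compact Hausdorff space. Second countability follows
   from compactness. The values of [coord i] outside [dom i], and those of
   [param i] outside the image of [coord i], are irrelevant. *)
Record closed_manifold (R : realType) (d : nat) := ClosedManifold {
  carrier :> topologicalType;
  compact_carrier : compact [set: carrier];
  hausdorff_carrier : hausdorff_space carrier;
  chart : choiceType;
  dom : chart -> set carrier;
  coord : chart -> carrier -> 'rV[R]_d;
  param : chart -> 'rV[R]_d -> carrier;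
  open_dom : forall i, open (dom i);
  dom_cover : forall x, exists i, dom i x;
  open_coord : forall i, open (coord i @` dom i);
  coordK : forall i x, dom i x -> param i (coord i x) = x;
  coord_continuous : forall i x, dom i x -> {for x, continuous (coord i)};
  param_continuous : forall i y, (coord i @` dom i) y ->
    {for y, continuous (param i)};
  transition_smooth : forall i j,
    smooth_open (coord i @` (dom i `&` dom j)) (coord j \o param i)
}.

Arguments compact_carrier {R d} c.
Arguments hausdorff_carrier {R d} c.

Section geometry.
Context {R : realType} {d : nat} (M : closed_manifold R d).

Definition img (i : chart M) : set 'rV[R]_d := coord i @` dom i.

Definition transition_jac (i j : chart M) (x : M) : 'M[R]_d :=
  'J (coord j \o param i) (coord i x).

(* A field on [M] is given by its components [a i : 'rV_d -> W] in each chart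
   [i]; only the values on [img i] matter, and each kind of field below comes
   with its own transformation law on the overlaps. *)
Definition field (W : Type) := chart M -> 'rV[R]_d -> W.

Definition smooth_field (W : normedModType R) (a : field W) : Prop :=
  forall i, smooth_open (img i) (a i).

Definition field_eq (W : Type) (a b : field W) : Prop :=
  forall i y, img i y -> a i y = b i y.

Definition smooth_function (f : M -> R) : Prop :=
  smooth_field (fun i y => f (param i y)).

Definition vector_field (v : field 'rV[R]_d) : Prop :=
  smooth_field v /\
  forall i j x, dom i x -> dom j x ->
    v j (coord j x) = v i (coord i x) *m transition_jac i j x.

Definition sym2_field (h : field 'M[R]_d) : Prop :=
  [/\ smooth_field h,
      forall i y, img i y -> (h i y)^T = h i y &
      forall i j x, dom i x -> dom j x ->
        h i (coord i x) =
        transition_jac i j x *m h j (coord j x) *m (transition_jac i j x)^T].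

Definition metric (g : field 'M[R]_d) : Prop :=
  sym2_field g /\
  forall i y (u : 'rV[R]_d), img i y -> u != 0 ->
    0 < (u *m g i y *m u^T) 0 0.

Definition density (rho : field R) : Prop :=
  [/\ smooth_field rho,
      forall i y, img i y -> 0 < rho i y &
      forall i j x, dom i x -> dom j x ->
        rho i (coord i x) =
        `|\det (transition_jac i j x)| * rho j (coord j x)].

Definition vol (g : field 'M[R]_d) : field R :=
  fun i y => Num.sqrt (\det (g i y)).

Definition partial (W : normedModType R) (c : 'I_d) (f : 'rV[R]_d -> W) :
    'rV[R]_d -> W :=
  'D_(delta_mx 0 c) f.

(* Coordinate formula for the Lie derivative of a covariant 2-tensor:
   (L_v g)_ab = v^c d_c g_ab + (d_a v^c) g_cb + (d_b v^c) g_ac *)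
Definition lie_sym2 (v : field 'rV[R]_d) (g : field 'M[R]_d) :
    field 'M[R]_d :=
  fun i y => \matrix_(a, b) \sum_c
    (v i y 0 c * partial c (g i) y a b
     + partial a (v i) y 0 c * g i y c b
     + partial b (v i) y 0 c * g i y a c).

(* Coordinate formula for the Lie derivative of a density:
   L_v rho = d_c (v^c rho) *)
Definition lie_density (v : field 'rV[R]_d) (rho : field R) : field R :=
  fun i y => \sum_c partial c (fun z => v i z 0 c * rho i z) y.

Lemma finite_subatlas : exists s : seq (chart M),
  forall x : M, exists2 i, i \in s & dom i x.
Proof.
pose F := filter_from [set: seq (chart M)]
  (fun s => [set t : seq (chart M) | {subset s <= t}]).
have FF : Filter F.
  apply: filter_from_filter; first by exists [::].
  move=> s t _ _; exists (s ++ t) => // u stu.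
  by split=> i /= ?; apply: stu; rewrite mem_cat; apply/orP; [left|right].
have /compact_near_coveringP cov := compact_carrier M.
pose P (s : seq (chart M)) (x : M) := exists2 i, i \in s & dom i x.
have [x _|s _ Hs] := cov _ F P FF.
  have [i ix] := dom_cover x.
  exists (dom i, [set t : seq (chart M) | i \in t]).
    split; first by apply: open_nbhs_nbhs; split=> //; exact: open_dom.
    by exists [:: i] => // t; apply; rewrite mem_head.
  by move=> [y t] [/= iy it]; exists i.
by exists s => x; exact: Hs.
Qed.

(* By Fubini, the Lebesgue integral over R^n of an integrable [F]. *)
Fixpoint iterated_integral (n : nat) : ('rV[R]_n -> R) -> \bar R :=
  if n is n'.+1 then
    fun F => (\int[lebesgue_measure]_x
      iterated_integral (fun y : 'rV[R]_n' => F (row_mx (x%:M : 'M[R]_1) y)))%E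
  else fun F => (F 0)%:E.

(* Integral of [w] over the points of [M] outside [A] that are covered by the
   charts in [s]: [M] is cut into the disjoint Borel pieces
   [dom i `\` (A `|` the domains before i)]. *)
Fixpoint integral_outside (A : set M) (s : seq (chart M)) (w : field R) :
    \bar R :=
  if s is i :: s' then
    (iterated_integral ((w i) \_ (coord i @` (dom i `\` A)))
     + integral_outside (A `|` dom i) s' w)%E
  else 0%E.

(* The value does not depend on the chosen finite subatlas when [w] obeys the
   transformation law of densities, by the change of variables formula. *)
Definition integral_density (w : field R) : \bar R :=
  integral_outside set0 (projT1 (cid finite_subatlas)) w.

Definition ebin (g h k : field 'M[R]_d) : \bar R :=
  integral_density (fun i y =>
    \tr (invmx (g i y) *m h i y *m invmx (g i y) *m k i y) * vol g i y).

Definition transport_cost (g0 : field 'M[R]_d) (v : field 'rV[R]_d)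
    (rho : field R) : \bar R :=
  integral_density (fun i y =>
    (v i y *m g0 i y *m (v i y)^T) 0 0 * rho i y).

Definition reaction_cost (f : M -> R) (rho : field R) : \bar R :=
  integral_density (fun i y => f (param i y) ^+ 2 * rho i y).

Definition wasserstein_ebin (g0 : field 'M[R]_d) (Lambda : R)
    (g dg : field 'M[R]_d) : \bar R :=
  ereal_inf [set E | exists (v : field 'rV[R]_d) (h : field 'M[R]_d),
    [/\ vector_field v, sym2_field h,
        field_eq dg (fun i y => - lie_sym2 v g i y + h i y) &
        E = (transport_cost g0 v (vol g) + (d%:R * Lambda / 4)%:E * ebin g h h)%E]].

Definition wasserstein_fisher_rao (g0 : field 'M[R]_d) (Lambda : R)
    (rho drho : field R) : \bar R :=
  ereal_inf [set E | exists (v : field 'rV[R]_d) (f : M -> R),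
    [/\ vector_field v, smooth_function f,
        field_eq drho (fun i y =>
          - lie_density v rho i y + f (param i y) * rho i y) &
        E = (transport_cost g0 v rho + Lambda%:E * reaction_cost f rho)%E]].

(* Piecewise smooth on [0, 1], jointly in time and space, which is smoothness
   of curves for the C^oo topology on a space of fields over compact [M]. *)
Definition piecewise_smooth (W : normedModType R) (gamma : R -> field W) :
    Prop :=
  exists s : seq R, itv_partition 0 1 s /\
    forall k, (k < size s)%N -> forall i,
      smooth_on (`[nth 0 (0 :: s) k, nth 0 s k] `*` img i)
        (fun p : R * 'rV[R]_d => gamma p.1 i p.2).

Definition path_in (W : normedModType R) (X : set (field W)) (a b : field W)
    (gamma : R -> field W) : Prop :=
  [/\ piecewise_smooth gamma, forall t, t \in `[0, 1] -> X (gamma t),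
      field_eq (gamma 0) a & field_eq (gamma 1) b].

Definition velocity (W : normedModType R) (gamma : R -> field W) (t : R) :
    field W :=
  fun i y => derive1 (fun s => gamma s i y) t.

(* The velocity is meaningless at the finitely many break points and at the
   end points, which form a null set. *)
Definition path_length (W : normedModType R)
    (G : field W -> field W -> \bar R) (gamma : R -> field W) : \bar R :=
  (\int[lebesgue_measure]_(t in `[0%R, 1%R])
     sqrte (G (gamma t) (velocity gamma t)))%E.

(* [G p] is the quadratic form of the Riemannian metric at the point [p]. *)
Definition geodesic_dist (W : normedModType R) (X : set (field W))
    (G : field W -> field W -> \bar R) (a b : field W) : \bar R :=
  ereal_inf [set path_length G gamma | gamma in path_in X a b].

Definition dist_E : field 'M[R]_d -> field 'M[R]_d -> \bar R :=
  geodesic_dist metric (fun g h => ebin g h h).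

Definition dist_WE (g0 : field 'M[R]_d) (Lambda : R) :
    field 'M[R]_d -> field 'M[R]_d -> \bar R :=
  geodesic_dist metric (wasserstein_ebin g0 Lambda).

Definition dist_WFR (g0 : field 'M[R]_d) (Lambda : R) :
    field R -> field R -> \bar R :=
  geodesic_dist density (wasserstein_fisher_rao g0 Lambda).

End geometry.

(* Main.v *)
(* Along a path [gamma] of metrics with velocity [-L_v g + h], Jacobi's formula
   [d sqrt (det g) = tr (g^-1 dg) / 2 * sqrt (det g)] gives
   [d vol (-L_v g + h) = -L_v (vol g) + f vol g] with [f = tr (g^-1 h) / 2], and
   Cauchy-Schwarz for the trace gives [f^2 <= dim M / 4 * tr (g^-1 h g^-1 h)]. So
   [vol] maps [gamma] to a path of densities that is no longer for the
   Wasserstein-Fisher-Rao metric than [gamma] for the Wasserstein-Ebin metric.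
   The upper bound takes [v = 0] and [h = gamma'] in the infimum. *)
Require Import Defs.
From mathcomp Require Import all_boot all_order all_algebra perm.
From mathcomp Require Import all_classical all_reals all_analysis.
From mathcomp Require Import measurable_realfun ring lra.
Import Order.TTheory GRing.Theory Num.Theory.
Import numFieldNormedType.Exports.

Set Implicit Arguments.
Unset Strict Implicit.
Unset Printing Implicit Defensive.

Local Open Scope classical_set_scope.
Local Open Scope ring_scope.

(** The integrands of the lengths are infima, about whose measurability in time nothing is known,
    and the inner integrals of an iterated integral raise the same question. Integrals are therefore
    compared only through monotonicity, a positive factor and a null exceptional set; no integral is
    ever split as a sum. The argument permits this because a competitor [(v, h)] and its image
    [(v, f)] have the same transport cost, [g0(v, v)] integrated against the same density [vol g],
    so only the reaction term has to be estimated. Smoothness is phrased through iterated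
    directional derivatives, so the chain rule appears only in three forms: linear outer map, affine
    inner map, scalar outer function. They suffice because the determinant is a polynomial, the
    inverse is given by Cramer's rule and the root is taken of a positive scalar. The same
    derivative formula for [sqrt (det g)] is used in space, to get the Lie derivative of [vol g],
    and in time, to get the velocity of [vol gamma]. *)

(** * Chain rules for directional derivatives *)

Section directional_derivatives.
Context {R : realType}.

Lemma is_derive_linear (V W W' : normedModType R) (L : W -> W')
    (f : V -> W) (x v : V) (df : W) :
  linear L -> continuous L -> is_derive x v f df ->
  is_derive x v (fun z => L (f z)) (L df).
Proof.
move=> linL cL [fx <-].
have LB u w : L (u - w) = L u - L w.
  by rewrite addrC -scaleN1r linL scaleN1r addrC.
have LZ a u : L (a *: u) = a *: L u.
  have L0 : L 0 = 0 by rewrite -(subrr 0) LB subrr.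
  by rewrite -[a *: u]addr0 linL L0 addr0.
have cv : h^-1 *: (L (f (h *: v + x)) - L (f x)) @[h --> 0^'] -->
    L ('D_v f x).
  have -> : (fun h : R => h^-1 *: (L (f (h *: v + x)) - L (f x))) =
      L \o (fun h => h^-1 *: (f (h *: v + x) - f x)).
    by apply/funext => h /=; rewrite LZ LB.
  by apply: cvg_comp; [exact: fx|exact: cL].
by apply: DeriveDef; [apply/cvg_ex; exists (L ('D_v f x))|exact: cvg_lim cv].
Qed.

(** Restriction to the line through [x] is what lets [is_derive_comp1] use the one-variable chain
    rule. *)
Lemma derive_line (V W : normedModType R) (f : V -> W) (x v : V) :
  'D_v f x = 'D_1 (fun h : R => f (h *: v + x)) 0.
Proof.
rewrite /derive; set g1 := fun h => h^-1 *: _; set g2 := fun h => h^-1 *: _.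
suff -> : g1 = g2 by [].
by rewrite funeqE /g1 /g2 => h /=; rewrite addr0 scale0r add0r [_%:A]mulr1.
Qed.

Lemma is_derive_comp1 (V : normedModType R) (phi : R -> R) (f : V -> R)
    (x v : V) (a b : R) :
  is_derive (f x) 1 phi a -> is_derive x v f b ->
  is_derive x v (fun z => phi (f z)) (a * b).
Proof.
move=> dphi [fx <-].
have df : is_derive (0 : R) 1 (fun h : R => f (h *: v + x)) ('D_v f x).
  apply: DeriveDef; last by rewrite -derive_line.
  exact: (iffLR (derivable1P f x v)) fx.
have := @is_derive1_comp R phi _ 0 a _ _ df.
rewrite scale0r add0r => /(_ dphi) [d0 e0].
apply: DeriveDef; last by rewrite derive_line.
exact: (iffRL (derivable1P _ x v)) d0.
Qed.

(** For [A] affine with linear part [L], the difference quotients of both sides are literally equal.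
    Used for the slices of space-time at fixed time or fixed point and for the projection to
    space. *)
Lemma is_derive_precomp (V' V W : normedModType R) (A L : V' -> V)
    (f : V -> W) (x v : V') (df : W) :
  (forall (h : R) y, A (h *: v + y) = h *: L v + A y) ->
  is_derive (A x) (L v) f df ->
  is_derive x v (fun z => f (A z)) df.
Proof.
move=> hA [fx <-].
have E : (fun h : R => h^-1 *: (f (A (h *: v + x)) - f (A x))) =
         (fun h => h^-1 *: (f (h *: L v + A x) - f (A x))).
  by apply/funext => h; rewrite hA.
by apply: DeriveDef; rewrite /derivable /derive /= E.
Qed.

Lemma is_derive_local (V W : normedModType R) (U : set V) (f g : V -> W)
    (x v : V) (df : W) :
  open U -> U x -> (forall z, U z -> f z = g z) ->
  is_derive x v f df -> is_derive x v g df.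
Proof.
move=> oU Ux fg; apply: near_eq_is_derive.
by apply: filterS fg _; exact: open_nbhs_nbhs.
Qed.

End directional_derivatives.

(** * Closure properties of C^k maps, by induction on k *)

Section smooth_maps.
Context {R : realType}.
Implicit Types (V W : normedModType R).

Lemma continuous_local V W (U : set V) (f g : V -> W) x :
  open U -> U x -> (forall z, U z -> f z = g z) ->
  {for x, continuous f} -> {for x, continuous g}.
Proof.
move=> oU Ux fg cf; rewrite /prop_for /continuous_at -(fg _ Ux).
apply: cvg_trans cf; apply: near_eq_cvg.
by apply: filterS fg _; exact: open_nbhs_nbhs.
Qed.

Lemma Ck_continuous V W k (U : set V) (f : V -> W) x :
  Ck k U f -> U x -> {for x, continuous f}.
Proof. by case: k => [|k] [cf _]; apply: cf. Qed.

Lemma Ck_is_derive V W k (U : set V) (f : V -> W) x v :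
  Ck k.+1 U f -> U x -> is_derive x v f ('D_v f x).
Proof. by move=> [_ df] Ux; have [dv _] := df v; apply/derivableP/dv. Qed.

Lemma Ck_derive V W k (U : set V) (f : V -> W) v :
  Ck k.+1 U f -> Ck k U ('D_v f).
Proof. by move=> [_ df]; have [] := df v. Qed.

Lemma Ck_eq V W k (U : set V) (f g : V -> W) :
  open U -> (forall x, U x -> f x = g x) -> Ck k U f -> Ck k U g.
Proof.
move=> oU; elim: k f g => [|k IH] f g fg Cf.
  by split=> // x Ux; exact: continuous_local oU Ux fg (Ck_continuous Cf Ux).
split=> [x Ux|v].
  exact: continuous_local oU Ux fg (Ck_continuous Cf Ux).
have dg x : U x -> is_derive x v g ('D_v f x).
  move=> Ux; apply: (is_derive_local oU Ux fg); exact: Ck_is_derive Cf Ux.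
split; first by move=> x /dg [].
apply: (IH ('D_v f)); last exact: Ck_derive.
by move=> x /dg [_ ->].
Qed.

(** The induction step of all the closure proofs: a formula [df] for the derivatives is known only
    on [U], whereas [Ck] speaks of the globally defined ['D_v f]; [Ck_eq] bridges the two. *)
Lemma Ck_step V W k (U : set V) (f : V -> W) (df : V -> V -> W) :
  open U -> (forall x, U x -> {for x, continuous f}) ->
  (forall v x, U x -> is_derive x v f (df v x)) ->
  (forall v, Ck k U (df v)) -> Ck k.+1 U f.
Proof.
move=> oU cf dfP Cdf; split=> // v; split; first by move=> x /(dfP v) [].
by apply: Ck_eq (Cdf v) => // x /(dfP v) [_ ->].
Qed.

(** The derivatives of products, inverses and roots contain the undifferentiated function, which
    must then be available one order lower. *)
Lemma Ck_pred V W k (U : set V) (f : V -> W) : Ck k.+1 U f -> Ck k U f.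
Proof.
elim: k f => [|k IH] f Cf; first by case: Cf.
split; first by case: Cf.
move=> v; split; first by case: Cf => _ /(_ v) [].
by apply: IH; exact: Ck_derive.
Qed.

Lemma Ck_subset V W k (U U' : set V) (f : V -> W) :
  U' `<=` U -> Ck k U f -> Ck k U' f.
Proof.
move=> sU; elim: k f => [|k IH] f [cf df].
  by split=> // x /sU; exact: cf.
split=> [x /sU|v]; first exact: cf.
by have [dv Cv] := df v; split; [move=> x /sU; exact: dv|exact: IH].
Qed.

Lemma Ck_cst V W k (U : set V) (a : W) : open U -> Ck k U (fun=> a : W).
Proof.
move=> oU; elim: k a => [|k IH] a; first by split=> // x _; exact: cvg_cst.
apply: (@Ck_step _ _ _ _ _ (fun _ _ => 0)) => //.
by move=> x _; exact: cvg_cst.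
Qed.

Lemma Ck_linear V W (W' : normedModType R) (L : W -> W') k
    (U : set V) (f : V -> W) :
  open U -> linear L -> continuous L -> Ck k U f -> Ck k U (fun x => L (f x)).
Proof.
move=> oU linL cL; have cLf (h : V -> W) x : {for x, continuous h} ->
    {for x, continuous (fun x => L (h x))}.
  by move=> ch; apply: continuous_comp => //; exact: cL.
elim: k f => [|k IH] f Cf; first by split=> // x /(Ck_continuous Cf)/cLf.
apply: (@Ck_step _ _ _ _ _ (fun v x => L ('D_v f x))) => //.
- by move=> x /(Ck_continuous Cf)/cLf.
- by move=> v x Ux; apply: is_derive_linear => //; exact: Ck_is_derive Cf Ux.
- by move=> v; apply: IH; exact: Ck_derive.
Qed.

Lemma Ck_precomp (V' V W : normedModType R) (A L : V' -> V) k (U : set V)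
    (U' : set V') (f : V -> W) :
  open U' -> continuous A ->
  (forall (h : R) v y, A (h *: v + y) = h *: L v + A y) ->
  U' `<=` A @^-1` U -> Ck k U f -> Ck k U' (fun x => f (A x)).
Proof.
move=> oU' cA hA sU; have cfA (h : V -> W) x : {for A x, continuous h} ->
    {for x, continuous (fun x => h (A x))}.
  by move=> ch; apply: continuous_comp => //; exact: cA.
elim: k f => [|k IH] f Cf.
  by split=> // x /sU/(Ck_continuous Cf)/cfA.
apply: (@Ck_step _ _ _ _ _ (fun v x => 'D_(L v) f (A x))) => //.
- by move=> x /sU/(Ck_continuous Cf)/cfA.
- move=> v x /sU Ux.
  exact: (is_derive_precomp (fun h y => hA h v y) (Ck_is_derive (L v) Cf Ux)).
- by move=> v; exact: (IH _ (Ck_derive (L v) Cf)).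
Qed.

Lemma CkD V W k (U : set V) (f g : V -> W) : open U ->
  Ck k U f -> Ck k U g -> Ck k U (fun x => f x + g x).
Proof.
move=> oU; elim: k f g => [|k IH] f g Cf Cg.
  split=> // x Ux; apply: continuousD; first exact: Ck_continuous Cf Ux.
  exact: Ck_continuous Cg Ux.
apply: (@Ck_step _ _ _ _ _ (fun v x => 'D_v f x + 'D_v g x)) => //.
- move=> x Ux; apply: continuousD; first exact: Ck_continuous Cf Ux.
  exact: Ck_continuous Cg Ux.
- move=> v x Ux; apply: is_deriveD; first exact: Ck_is_derive Cf Ux.
  exact: Ck_is_derive Cg Ux.
- by move=> v; apply: IH; exact: Ck_derive.
Qed.

Lemma Ck_sum V W k (U : set V) (I : Type) (r : seq I) (P : pred I)
    (f : I -> V -> W) : open U ->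
  (forall i, P i -> Ck k U (f i)) ->
  Ck k U (fun x => \sum_(i <- r | P i) f i x).
Proof.
move=> oU Cf; elim: r => [|i r IH].
  rewrite (_ : (fun x => _) = fun=> 0); first exact: Ck_cst.
  by apply/funext => x; rewrite big_nil.
case Pi : (P i); last first.
  rewrite (_ : (fun x => _) = fun x => \sum_(j <- r | P j) f j x) //.
  by apply/funext => x; rewrite big_cons Pi.
rewrite (_ : (fun x => _) =
    fun x => f i x + \sum_(j <- r | P j) f j x).
  by apply: CkD => //; exact: Cf.
by apply/funext => x; rewrite big_cons Pi.
Qed.

Lemma CkM V k (U : set V) (f g : V -> R) : open U ->
  Ck k U f -> Ck k U g -> Ck k U (fun x => f x * g x).
Proof.
move=> oU; elim: k f g => [|k IH] f g Cf Cg.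
  split=> // x Ux; apply: continuousM; first exact: Ck_continuous Cf Ux.
  exact: Ck_continuous Cg Ux.
apply: (@Ck_step _ _ _ _ _ (fun v x => f x * 'D_v g x + g x * 'D_v f x)) => //.
- move=> x Ux; apply: continuousM; first exact: Ck_continuous Cf Ux.
  exact: Ck_continuous Cg Ux.
- move=> v x Ux; apply: is_deriveM; first exact: Ck_is_derive Cf Ux.
  exact: Ck_is_derive Cg Ux.
- move=> v; apply: CkD => //.
    by apply: IH; [exact: Ck_pred|exact: Ck_derive].
  by apply: IH; [exact: Ck_pred|exact: Ck_derive].
Qed.

Lemma Ck_prod V k (U : set V) (I : Type) (r : seq I) (P : pred I)
    (f : I -> V -> R) : open U ->
  (forall i, P i -> Ck k U (f i)) ->
  Ck k U (fun x => \prod_(i <- r | P i) f i x).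
Proof.
move=> oU Cf; elim: r => [|i r IH].
  rewrite (_ : (fun x => _) = fun=> 1); first exact: Ck_cst.
  by apply/funext => x; rewrite big_nil.
case Pi : (P i); last first.
  rewrite (_ : (fun x => _) = fun x => \prod_(j <- r | P j) f j x) //.
  by apply/funext => x; rewrite big_cons Pi.
rewrite (_ : (fun x => _) =
    fun x => f i x * \prod_(j <- r | P j) f j x).
  by apply: CkM => //; exact: Cf.
by apply/funext => x; rewrite big_cons Pi.
Qed.

Lemma CkV V k (U : set V) (f : V -> R) : open U ->
  (forall x, U x -> f x != 0) -> Ck k U f -> Ck k U (fun x => (f x)^-1).
Proof.
move=> oU f0; elim: k f f0 => [|k IH] f f0 Cf.
  split=> // x Ux; apply: continuousV; first exact: f0.
  exact: Ck_continuous Cf Ux.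
apply: (@Ck_step _ _ _ _ _
  (fun v x => ((-1) * ((f x)^-1 * (f x)^-1)) * 'D_v f x)) => //.
- by move=> x Ux; apply: continuousV; [exact: f0|exact: Ck_continuous Cf Ux].
- move=> v x Ux; have [d0 _] := Ck_is_derive v Cf Ux; have fx0 := f0 x Ux.
  apply: DeriveDef; first exact: derivableV.
  by rewrite deriveV// mulN1r -expr2 exprVn.
- move=> v; have Cfi := IH _ f0 (Ck_pred Cf); apply: CkM (Ck_derive v Cf) => //.
  by apply: CkM; [|exact: Ck_cst|exact: CkM].
Qed.

Lemma Ck_sqrt V k (U : set V) (f : V -> R) : open U ->
  (forall x, U x -> 0 < f x) -> Ck k U f -> Ck k U (fun x => Num.sqrt (f x)).
Proof.
move=> oU f0.
have cs (h : V -> R) x : {for x, continuous h} ->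
    {for x, continuous (fun x => Num.sqrt (h x))}.
  by move=> ch; apply: continuous_comp => //; exact: sqrt_continuous.
elim: k f f0 => [|k IH] f f0 Cf; first by split=> // x /(Ck_continuous Cf)/cs.
apply: (@Ck_step _ _ _ _ _
  (fun v x => (2 * Num.sqrt (f x))^-1 * 'D_v f x)) => //.
- by move=> x /(Ck_continuous Cf)/cs.
- move=> v x Ux; apply: is_derive_comp1; last exact: Ck_is_derive Cf Ux.
  by apply: is_derive1_sqrt; exact: f0.
- move=> v; apply: CkM (Ck_derive v Cf) => //; apply: CkV => //.
    by move=> x Ux; rewrite mulf_neq0// gt_eqF// sqrtr_gt0 f0.
  by apply: CkM; [|exact: Ck_cst|apply: IH => //; exact: Ck_pred].
Qed.

End smooth_maps.

(** * Positive definite matrices: determinant and trace inequalities *)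

Section positive_definite.
Context {R : realType}.

Definition posdef n (A : 'M[R]_n) :=
  A^T = A /\ forall u : 'rV[R]_n, u != 0 -> 0 < (u *m A *m u^T) 0 0.

Lemma posdef_unitmx n (A : 'M[R]_n) : posdef A -> A \in unitmx.
Proof.
move=> [_ A0]; rewrite -row_free_unit -kermx_eq0.
apply/negPn/negP => /rowV0Pn[u /sub_kermxP uA u0].
by have := A0 _ u0; rewrite uA mul0mx mxE ltxx.
Qed.

Lemma block_quadratic_form n (a x : R) (b w : 'rV[R]_n) (D : 'M[R]_n) :
  (row_mx (x%:M : 'M[R]_1) w *m block_mx a%:M b b^T D *m
    (row_mx (x%:M : 'M[R]_1) w)^T) 0 0 =
  x ^+ 2 * a + (x * (w *m b^T) 0 0) *+ 2 + (w *m D *m w^T) 0 0.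
Proof.
have E : (b *m w^T) 0 0 = (w *m b^T) 0 0.
  by rewrite !mxE; apply: eq_bigr => i _; rewrite !mxE mulrC.
rewrite tr_row_mx mul_row_block mul_row_col !mulmxDl tr_scalar_mx.
rewrite -scalar_mxM !mul_scalar_mx -scalemxAl mul_mx_scalar.
have -> (X Y Z T : 'M[R]_1) :
  (X + Y + (Z + T)) 0 0 = X 0 0 + (Y 0 0 + (Z 0 0 + T 0 0)).
  by rewrite mxE [(X + Y) 0 0]mxE [(Z + T) 0 0]mxE -addrA.
have sE (c : R) (X : 'M[R]_1) : (c *: X) 0 0 = c * X 0 0 by rewrite mxE.
by rewrite !sE E mxE mulr1n mulr2n !addrA expr2 mulrAC.
Qed.

(* Block elimination: with [S] the Schur complement [D - b^T b / a], the
   factor of [[a, b], [b^T, D]] is [[sqrt a, b / sqrt a], [0, chol S]]. *)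
Lemma posdef_cholesky n (A : 'M[R]_n) :
  posdef A -> exists C : 'M[R]_n, A = C^T *m C.
Proof.
elim: n A => [|n IH]; first by exists 0; rewrite [A]flatmx0 [RHS]flatmx0.
rewrite -[n.+1]/(1 + n)%N => A [sA pA].
pose a := (ulsubmx A) 0 0; pose b := ursubmx A; pose D := drsubmx A.
have EA : A = block_mx a%:M b b^T D.
  rewrite -[LHS]submxK [ulsubmx A]mx11_scalar.
  by rewrite /b trmx_ursub sA.
have sD : D^T = D by rewrite trmx_drsub sA.
have a0 : 0 < a.
  have := pA (row_mx (1%:M : 'M[R]_1) 0); rewrite {1}EA block_quadratic_form.
  rewrite !mul0mx !mxE mulr0 mul0rn expr1n mul1r !addr0; apply.
  apply/eqP => /(congr1 (fun B => lsubmx B 0 0)); rewrite row_mxKl !mxE.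
  by apply/eqP; rewrite oner_eq0.
have [C EC] : exists C : 'M[R]_n, D - a^-1 *: (b^T *m b) = C^T *m C.
  apply: IH; split; first by rewrite linearB linearZ /= sD trmx_mul trmxK.
  move=> w w0; have bw : (b *m w^T) 0 0 = (w *m b^T) 0 0.
    by rewrite !mxE; apply: eq_bigr => i _; rewrite !mxE mulrC.
  have wbbw : (w *m (b^T *m b) *m w^T) 0 0 = (w *m b^T) 0 0 ^+ 2.
    by rewrite !mulmxA -mulmxA mxE big_ord1 bw expr2.
  (* This [x] minimizes the quadratic form at [(x, w)] for fixed [w]; the minimum is the form of the
     Schur complement at [w]. *)
  pose x := - a^-1 * (w *m b^T) 0 0.
  have := pA (row_mx (x%:M : 'M[R]_1) w); rewrite {1}EA block_quadratic_form.
  have -> : (w *m (D - a^-1 *: (b^T *m b)) *m w^T) 0 0 =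
    (w *m D *m w^T) 0 0 - a^-1 * (w *m b^T) 0 0 ^+ 2.
    rewrite mulmxBr mulmxBl -scalemxAr -scalemxAl -wbbw.
    by rewrite [LHS]mxE; congr (_ + _); rewrite !mxE.
  have -> : x ^+ 2 * a + x * (w *m b^T) 0 0 *+ 2 =
    - (a^-1 * (w *m b^T) 0 0 ^+ 2).
    by rewrite /x; field; rewrite gt_eqF.
  rewrite addrC; apply.
  by apply: contra w0 => /eqP/(congr1 rsubmx); rewrite row_mxKr linear0 => ->.
have sa : Num.sqrt a != 0 by rewrite gt_eqF// sqrtr_gt0.
exists (block_mx (Num.sqrt a)%:M ((Num.sqrt a)^-1 *: b) 0 C).
rewrite {1}EA tr_block_mx mulmx_block !tr_scalar_mx !trmx0 !mul0mx !addr0.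
rewrite -scalar_mxM -expr2 sqr_sqrtr ?ltW// mulmx0 addr0.
rewrite mul_scalar_mx scalerA mulfV// scale1r linearZ /=.
rewrite mul_mx_scalar scalerA mulfV// scale1r -scalemxAl -scalemxAr scalerA.
by rewrite -invfM -expr2 sqr_sqrtr ?ltW// -EC addrC subrK.
Qed.

(** By the factorization the determinant is a square, nonzero since [A] is invertible. *)
Lemma det_posdef n (A : 'M[R]_n) : posdef A -> 0 < \det A.
Proof.
move=> pA; have := posdef_unitmx pA; have [C ->] := posdef_cholesky pA.
by rewrite unitmxE unitfE det_mulmx det_tr -expr2 lt0r sqr_ge0 => ->.
Qed.

(** With [g = C^T C] and [B = C^-1], cyclicity turns the trace into [tr (S S^T)] for the symmetric
    matrix [S = B^T k B], a sum of squares. *)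
Lemma mxtrace_posdef_ge0 n (g k : 'M[R]_n) : posdef g -> k^T = k ->
  0 <= \tr (invmx g *m k *m invmx g *m k).
Proof.
move=> pg sk; have ug := posdef_unitmx pg; have [C E] := posdef_cholesky pg.
have uC : C \in unitmx by move: ug; rewrite E unitmx_mul => /andP[].
have -> : invmx g = invmx C *m (invmx C)^T.
  apply: (can_inj (mulKmx ug)); rewrite mulmxV// E trmx_inv mulmxA.
  by rewrite -[X in X *m _]mulmxA mulmxV// mulmx1 mulmxV// unitmx_tr.
set B := invmx C; pose S := B^T *m k *m B.
have -> : \tr (B *m B^T *m k *m (B *m B^T) *m k) = \tr (S *m S^T).
  transitivity (\tr (B *m (B^T *m k *m (B *m B^T) *m k))).
    by rewrite !mulmxA.
  by rewrite mxtrace_mulC /S !trmx_mul trmxK sk !mulmxA.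
rewrite /mxtrace sumr_ge0// => i _; rewrite mxE sumr_ge0// => j _.
by rewrite [S^T _ _]mxE -expr2 sqr_ge0.
Qed.

(* Applied to the trace-free part [h - (tr (g^-1 h) / n) g] of [h], the
   positivity of [mxtrace_posdef_ge0] is the Cauchy-Schwarz inequality. *)
Lemma mxtrace_posdef_sqr n (g h : 'M[R]_n) : posdef g -> h^T = h ->
  (\tr (invmx g *m h)) ^+ 2 <=
    n%:R * \tr (invmx g *m h *m invmx g *m h).
Proof.
case: n g h => [|n] g h pg sh.
  by rewrite /mxtrace !big_ord0 mul0r expr0n.
have ug := posdef_unitmx pg; rewrite -mulmxA.
set A := invmx g *m h; set t := \tr A; set c := t / n.+1%:R.
have := @mxtrace_posdef_ge0 _ g (h - c *: g) pg.
rewrite linearB linearZ /= sh pg.1 => /(_ erefl).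
have -> : invmx g *m (h - c *: g) = A - c%:M.
  by rewrite mulmxBr -scalemxAr mulVmx// scalemx1.
rewrite -mulmxA; have -> : invmx g *m (h - c *: g) = A - c%:M.
  by rewrite mulmxBr -scalemxAr mulVmx// scalemx1.
rewrite mulmxBl !mulmxBr mul_scalar_mx mul_mx_scalar -scalar_mxM.
rewrite !raddfB /= !mxtraceZ mxtrace_scalar -/t opprK.
rewrite -[c * c *+ _]mulr_natr => H.
rewrite -subr_ge0; set q := \tr (A *m A) in H *.
have n0 : (0 : R) < n.+1%:R by rewrite ltr0n.
(* The second factor is the expansion of [tr ((A - c)^2)], nonnegative by [H]. *)
have -> : n.+1%:R * q - t ^+ 2 =
    n.+1%:R * (q - c * t + (- (c * t) + c * c * n.+1%:R)).
  by rewrite /c; field; rewrite gt_eqF.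
by rewrite mulr_ge0// ltW.
Qed.

End positive_definite.

(** * Smoothness of matrix operations and Jacobi's formula *)

Section matrix_calculus.
Context {R : realType}.
Implicit Types V : normedModType R.

Lemma linear_coord m n i j :
  linear (fun A : 'M[R]_(m, n) => A i j : R).
Proof. by move=> a A B; rewrite !mxE. Qed.

Lemma Ck_coord V m n k (U : set V) (f : V -> 'M[R]_(m, n)) i j :
  open U -> Ck k U f -> Ck k U (fun x => f x i j).
Proof.
move=> oU.
apply: (@Ck_linear _ _ _ _ (fun A : 'M[R]_(m, n) => A i j : R)) => //.
  exact: linear_coord.
exact: coord_continuous.
Qed.

Lemma is_derive_coord V m n (f : V -> 'M[R]_(m, n)) (x v : V) df i j :
  is_derive x v f df -> is_derive x v (fun z => f z i j) (df i j).
Proof.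
apply: (@is_derive_linear _ _ _ _ (fun A : 'M[R]_(m, n) => A i j : R)).
  exact: linear_coord.
exact: coord_continuous.
Qed.

Lemma Ck_matrix V m n k (U : set V) (f : V -> 'M[R]_(m, n)) :
  open U -> (forall i j, Ck k U (fun x => f x i j)) -> Ck k U f.
Proof.
move=> oU Cf.
rewrite (_ : f = fun x => \sum_i \sum_j (f x i j) *: delta_mx i j); last first.
  by apply/funext => x; exact: matrix_sum_delta.
apply: Ck_sum => // i _; apply: Ck_sum => // j _.
apply: (@Ck_linear _ _ _ _ (fun r : R => r *: delta_mx i j)) => //.
  by move=> a r s; rewrite scalerDl scalerA.
exact: scalel_continuous.
Qed.

Lemma Ck_mulmx V m n p k (U : set V) (f : V -> 'M[R]_(m, n))
    (g : V -> 'M[R]_(n, p)) :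
  open U -> Ck k U f -> Ck k U g -> Ck k U (fun x => f x *m g x).
Proof.
move=> oU Cf Cg; apply: Ck_matrix => // i j.
rewrite (_ : (fun x => _) = fun x => \sum_l f x i l * g x l j).
  by apply: Ck_sum => // l _; apply: CkM => //; exact: Ck_coord.
by apply/funext => x; rewrite mxE.
Qed.

Lemma Ck_det V n k (U : set V) (f : V -> 'M[R]_n) :
  open U -> Ck k U f -> Ck k U (fun x => \det (f x)).
Proof.
move=> oU Cf; apply: Ck_sum => // s _; apply: CkM => //; first exact: Ck_cst.
by apply: Ck_prod => // i _; exact: Ck_coord.
Qed.

Lemma Ck_invmx V n k (U : set V) (f : V -> 'M[R]_n) :
  open U -> (forall x, U x -> f x \in unitmx) -> Ck k U f ->
  Ck k U (fun x => invmx (f x)).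
Proof.
move=> oU uf Cf; apply: Ck_matrix => // i j.
(* Cramer's rule, entry by entry. It describes [invmx] only at invertible matrices, hence the
   passage to a function equal on [U]. *)
apply: (@Ck_eq _ _ _ _ _ (fun x => (\det (f x))^-1 *
    ((-1) ^+ (j + i) * \det (row' j (col' i (f x)))))) => //.
  by move=> x /uf ufx; rewrite /invmx ufx !mxE.
apply: CkM => //.
  apply: CkV => //; last exact: Ck_det.
  by move=> x /uf; rewrite unitmxE unitfE.
apply: CkM => //; first exact: Ck_cst.
apply: Ck_det => //; apply: Ck_matrix => // a b.
rewrite (_ : (fun x => _) = fun x => f x (lift j a) (lift i b)).
  exact: Ck_coord.
by apply/funext => x; rewrite !mxE.
Qed.

Lemma Ck_mxtrace V n k (U : set V) (f : V -> 'M[R]_n) :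
  open U -> Ck k U f -> Ck k U (fun x => \tr (f x)).
Proof. by move=> oU Cf; apply: Ck_sum => // i _; exact: Ck_coord. Qed.

Lemma is_derive_sumr V (I : Type) (r : seq I) (f : I -> V -> R) (df : I -> R)
    (x v : V) :
  (forall i, is_derive x v (f i) (df i)) ->
  is_derive x v (fun z => \sum_(i <- r) f i z) (\sum_(i <- r) df i).
Proof.
move=> dfP; elim: r => [|i r IH].
  rewrite big_nil (_ : (fun z => _) = cst 0); first exact: is_derive_cst.
  by apply/funext => z; rewrite big_nil.
rewrite big_cons (_ : (fun z => _) = f i + (fun z => \sum_(j <- r) f j z)).
  exact: is_deriveD.
by apply/funext => z; rewrite big_cons.
Qed.

(** The Leibniz rule is written with a conditional factor so that each summand is a term of the
    determinant of a matrix with one row replaced, as in [is_derive_det]. *)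
Lemma is_derive_prod V n (f : 'I_n -> V -> R) (df : 'I_n -> R) (x v : V) :
  (forall i, is_derive x v (f i) (df i)) ->
  is_derive x v (fun z => \prod_i f i z)
    (\sum_i \prod_j (if j == i then df j else f j x)).
Proof.
elim: n f df => [|n IH] f df dfP.
  rewrite big_ord0 (_ : (fun z => _) = cst 1); first exact: is_derive_cst.
  by apply/funext => z; rewrite big_ord0.
rewrite (_ : (fun z => _) = f ord0 * (fun z => \prod_i f (lift ord0 i) z)).
  apply: is_derive_eq.
    by apply: is_deriveM; apply: IH => i; exact: dfP.
  rewrite big_ord_recl addrC /=; congr (_ + _).
    by rewrite big_ord_recl eqxx mulrC.
  rewrite [LHS]mulr_sumr; apply: eq_bigr => i _.
  rewrite [RHS]big_ord_recl; congr (_ * _); apply: eq_bigr => j _.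
by apply/funext => z; rewrite big_ord_recl.
Qed.

Lemma is_derive_det V n (f : V -> 'M[R]_n) (df : 'M[R]_n) (x v : V) :
  is_derive x v f df ->
  is_derive x v (fun z => \det (f z)) (\tr (\adj (f x) *m df)).
Proof.
move=> dfP.
pose M i : 'M[R]_n := \matrix_(j, k) if j == i then df j k else f x j k.
(* Laplace expansion of [M i] along row [i]: the cofactors there are those of [f x], because the two
   matrices differ only in that row. The Leibniz formula is then differentiated term by term. *)
have -> : \tr (\adj (f x) *m df) = \sum_i \det (M i).
  rewrite mxtrace_mulC; apply: eq_bigr => i _.
  rewrite (expand_det_row _ i) mxE; apply: eq_bigr => j _.
  rewrite !mxE eqxx; congr (_ * (_ * \det _)).
  by apply/matrixP => a b; rewrite !mxE eq_sym (negPf (neq_lift i a)).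
have -> : \sum_i \det (M i) = \sum_(s : {perm 'I_n}) (-1) ^+ s *
    \sum_i \prod_j (if j == i then df j (s j) else f x j (s j)).
  rewrite exchange_big; apply: eq_bigr => s _; rewrite mulr_sumr.
  apply: eq_bigr => i _; congr (_ * _); apply: eq_bigr => j _.
  by rewrite mxE.
apply: is_derive_sumr => s.
apply: is_derive_eq.
  apply: is_deriveM; apply: is_derive_prod => i.
  exact: is_derive_coord.
by rewrite scaler0 addr0.
Qed.

End matrix_calculus.

(** * Monotonicity of integrals, for possibly nonmeasurable integrands *)

Section integrals_without_measurability.
Context {R : realType}.
Local Open Scope ereal_scope.
Import HBNNSimple.

(* The integral of a nonnegative function is the supremum of the integrals of
   the simple functions below it, so no measurability is needed here. *)
Lemma ge0_le_integralZ_null dsp (T : measurableType dsp)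
    (mu : {measure set T -> \bar R}) (D N : set T) (c : R) (f g : T -> \bar R) :
  (0 < c)%R -> measurable N -> mu N = 0 ->
  (forall x, D x -> 0 <= f x) -> (forall x, D x -> 0 <= g x) ->
  (forall x, D x -> ~ N x -> f x <= c%:E * g x) ->
  \int[mu]_(x in D) f x <= c%:E * \int[mu]_(x in D) g x.
Proof.
move=> c0 mN N0 f0 g0 fg; rewrite !ge0_integralE//.
apply: ge_ereal_sup => _ [h hf <-].
have mCN : measurable (setT `\` N) by exact: measurableD.
have ci : (0 <= c^-1)%R by rewrite invr_ge0 ltW.
(* On [N] nothing relates [f] to [g], so [h] is cut off there, at no cost since [N] is null;
   division by [c] then brings it below [g]. *)
pose h' := proj_nnsfun h mCN; pose k := scale_nnsfun h' ci.
have -> : sintegral mu h = sintegral mu h'.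
  rewrite -[sintegral mu h'](congr1 (sintegral mu) (mrestrict h mCN)).
  rewrite -integral_nnsfun// -ge0_negligible_integral//.
  - by rewrite integral_nnsfun// patch_setT.
  - exact/measurable_EFinP.
  - by move=> x _; rewrite lee_fin.
have -> : sintegral mu h' = c%:E * sintegral mu k.
  rewrite -sintegralrM; apply: eq_sintegral => x /=.
  by rewrite mulrA mulfV ?gt_eqF// mul1r.
rewrite lee_pmul2l ?lte_fin//; apply: ereal_sup_ubound; exists k => // x /=.
rewrite mindicE /patch; case: ifPn => [|/negP] xD.
  have {}xD : D x by rewrite inE in xD.
  case: (boolP (x \in setT `\` N)) => [|_]; last by rewrite !mulr0 g0.
  rewrite inE => -[_ Nx]; rewrite mulr1 -(@lee_pmul2l _ c%:E) ?lte_fin//.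
  rewrite -EFinM mulrA mulfV ?gt_eqF// mul1r (le_trans _ (fg _ _ _))//.
  by have := hf x; rewrite /patch mem_set.
have := hf x; rewrite /patch; case: ifPn => // _; rewrite lee_fin => hx.
rewrite lee_fin mulr_ge0_le0// -(mul0r (x \in setT `\` N)%:R).
by rewrite ler_wpM2r.
Qed.

Lemma ge0_le_integralZ dsp (T : measurableType dsp)
    (mu : {measure set T -> \bar R}) (D : set T) (c : R) (f g : T -> \bar R) :
  (0 < c)%R ->
  (forall x, D x -> 0 <= f x) -> (forall x, D x -> 0 <= g x) ->
  (forall x, D x -> f x <= c%:E * g x) ->
  \int[mu]_(x in D) f x <= c%:E * \int[mu]_(x in D) g x.
Proof.
move=> c0 f0 g0 fg; apply: (@ge0_le_integralZ_null _ _ _ _ set0) => //.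
by move=> x Dx _; exact: fg.
Qed.

Lemma iterated_integral_ge0 n (F : 'rV[R]_n -> R) :
  (forall x, 0 <= F x)%R -> 0 <= iterated_integral F.
Proof.
elim: n F => [|n IH] F F0 /=; first by rewrite lee_fin.
by apply: integral_ge0 => x _; exact: IH.
Qed.

Lemma le_iterated_integralZ n (c : R) (F G : 'rV[R]_n -> R) : (0 < c)%R ->
  (forall x, 0 <= F x)%R -> (forall x, 0 <= G x)%R ->
  (forall x, F x <= c * G x)%R ->
  iterated_integral F <= c%:E * iterated_integral G.
Proof.
move=> c0; elim: n F G => [|n IH] F G F0 G0 FG /=.
  by rewrite -EFinM lee_fin.
apply: ge0_le_integralZ => // x _; [exact: iterated_integral_ge0..|].
exact: IH.
Qed.

Lemma iterated_integral0 n : iterated_integral (fun _ : 'rV[R]_n => 0%R) = 0.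
Proof. by elim: n => //= n IH; rewrite integral0_eq. Qed.

Section densities.
Context {d : nat} (M : closed_manifold R d).

Lemma integral_outside_ge0 (A : set M) s (w : field M R) :
  (forall i y, img i y -> 0 <= w i y)%R -> 0 <= integral_outside A s w.
Proof.
move=> w0; elim: s A => //= i s IH A; rewrite adde_ge0//.
apply: iterated_integral_ge0 => x; rewrite /patch; case: ifP => //.
by rewrite inE => -[y [yi _] <-]; apply: w0; exists y.
Qed.

Lemma le_integral_outsideZ (c : R) (A : set M) s (w w' : field M R) :
  (0 < c)%R ->
  (forall i y, img i y -> 0 <= w i y)%R ->
  (forall i y, img i y -> 0 <= w' i y)%R ->
  (forall i y, img i y -> w i y <= c * w' i y)%R ->
  integral_outside A s w <= c%:E * integral_outside A s w'.
Proof.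
move=> c0 w0 w'0 ww'; elim: s A => [|i s IH] A /=; first by rewrite mule0.
have patch_ge0 (u : field M R) : (forall i y, img i y -> 0 <= u i y)%R ->
    forall x, (0 <= ((u i) \_ (Defs.coord i @` (dom i `\` A))) x)%R.
  move=> u0 x; rewrite /patch; case: ifP => //.
  by rewrite inE => -[y [yi _] <-]; apply: u0; exists y.
rewrite ge0_muleDr; last 2 first.
  by apply: iterated_integral_ge0; exact: patch_ge0.
  exact: integral_outside_ge0.
apply: leeD; last exact: IH.
apply: le_iterated_integralZ => //; [exact: patch_ge0..|].
move=> x; rewrite /patch; case: ifP => [|_]; last by rewrite mulr0.
by rewrite inE => -[y [yi _] <-]; apply: ww'; exists y.
Qed.

Lemma integral_density_ge0 (w : field M R) :
  (forall i y, img i y -> 0 <= w i y)%R -> 0 <= integral_density w.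
Proof. exact: integral_outside_ge0. Qed.

Lemma le_integral_densityZ (c : R) (w w' : field M R) : (0 < c)%R ->
  (forall i y, img i y -> 0 <= w i y)%R ->
  (forall i y, img i y -> 0 <= w' i y)%R ->
  (forall i y, img i y -> w i y <= c * w' i y)%R ->
  integral_density w <= c%:E * integral_density w'.
Proof. exact: le_integral_outsideZ. Qed.

Lemma integral_density0 : @integral_density R d M (fun _ _ => 0%R) = 0.
Proof.
rewrite /integral_density; elim: (projT1 _) set0 => //= i s IH A.
rewrite IH adde0 -[RHS](iterated_integral0 d); congr iterated_integral.
by apply/funext => x; rewrite /patch; case: ifP.
Qed.

End densities.

End integrals_without_measurability.

(** * Derivative of the volume element, with auxiliary facts *)

Section more_calculus.
Context {R : realType}.
Implicit Types V W : normedModType R.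

Lemma is_derive_unique V W (f : V -> W) (x v : V) (a b : W) :
  is_derive x v f a -> is_derive x v f b -> a = b.
Proof. by move=> [_ <-] [_ <-]. Qed.

Lemma Ck_id V k (U : set V) : open U -> Ck k U (fun x : V => x).
Proof.
move=> oU; case: k => [|k]; first by split=> // x _; exact: cvg_id.
apply: (@Ck_step _ _ _ _ _ _ (fun v _ => v)) => //.
- by move=> x _; exact: cvg_id.
- by move=> v; exact: Ck_cst.
Qed.

(** Expansion in elementary matrices. It lets the time derivative commute with transposition and
    with the change of charts in [sym2_field_velocity]. *)
Lemma linear_matrix_continuous m n W (L : 'M[R]_(m, n) -> W) :
  linear L -> continuous L.
Proof.
move=> linL.
have L0 : L 0 = 0.
  by have := linL (-1) 0 0; rewrite scaleN1r oppr0 addr0 scaleN1r addNr.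
have LD A B : L (A + B) = L A + L B by rewrite -[A]scale1r linL !scale1r.
have LZ a A : L (a *: A) = a *: L A by rewrite -[a *: A]addr0 linL L0 addr0.
have -> : L = fun A => \sum_i \sum_j A i j *: L (delta_mx i j).
  apply/funext => A; rewrite {1}[A]matrix_sum_delta.
  rewrite (big_morph _ LD L0); apply: eq_bigr => i _.
  by rewrite (big_morph _ LD L0); apply: eq_bigr => j _; rewrite LZ.
suff : Ck 0 setT (fun A : 'M[R]_(m, n) =>
    \sum_i \sum_j A i j *: L (delta_mx i j)).
  by move=> [cL _] A; exact: cL.
apply: Ck_sum => [|i _]; first exact: openT.
apply: Ck_sum => [|j _]; first exact: openT.
apply: (@Ck_linear _ _ _ _ (fun r : R => r *: L (delta_mx i j))) => //.
- exact: openT.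
- by move=> a r s; rewrite scalerDl scalerA.
- exact: scalel_continuous.
- by apply: Ck_coord; [exact: openT|apply: Ck_id; exact: openT].
Qed.

(** [V] is kept general because it is the coordinate space in [lie_density_vol] and the time axis in
    [dist_WFR_le_WE]. *)
Lemma is_derive_sqrt_det V n (f : V -> 'M[R]_n) (df : 'M[R]_n) (x v : V) :
  posdef (f x) -> is_derive x v f df ->
  is_derive x v (fun z => Num.sqrt (\det (f z)))
    (\tr (invmx (f x) *m df) / 2 * Num.sqrt (\det (f x))).
Proof.
move=> pf dfP; have d0 := det_posdef pf; have uf := posdef_unitmx pf.
apply: is_derive_eq.
  apply: is_derive_comp1 (is_derive_det dfP).
  exact: is_derive1_sqrt.
have -> : \adj (f x) = \det (f x) *: invmx (f x).
  by rewrite /invmx uf scalerA mulfV ?scale1r// gt_eqF.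
rewrite -scalemxAl mxtraceZ -{2}(sqr_sqrtr (ltW d0)).
have s0 : Num.sqrt (\det (f x)) != 0 by rewrite gt_eqF// sqrtr_gt0.
by field.
Qed.

Lemma open_pos_preimage V (O : set V) (f : V -> R) :
  open O -> (forall x, O x -> {for x, continuous f}) ->
  open (O `&` [set x | 0 < f x]).
Proof.
move=> oO cf; rewrite openE => x [Ox fx]; apply: filterI.
  by rewrite nbhsE; exists O.
exact: (cvgr_gt _ (cf x Ox) _ fx).
Qed.

(** Chart independence of [tr (g^-1 h)], with [J] the Jacobian of a transition map. *)
Lemma mxtrace_invmx_congr n (J G H : 'M[R]_n) :
  J \in unitmx -> G \in unitmx ->
  \tr (invmx (J *m G *m J^T) *m (J *m H *m J^T)) = \tr (invmx G *m H).
Proof.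
move=> uJ uG; have uJT : J^T \in unitmx by rewrite unitmx_tr.
have uJGJ : J *m G *m J^T \in unitmx by rewrite !unitmx_mul uJ uG.
have -> : invmx (J *m G *m J^T) = invmx J^T *m (invmx G *m invmx J).
  apply: (can_inj (mulKmx uJGJ)); rewrite mulmxV//.
  by rewrite !mulmxA mulmxK// mulmxK// mulmxV.
by rewrite -mulmxA mxtrace_mulC -!mulmxA mulKmx// mulmxV// mulmx1.
Qed.

Lemma continuous_pairl (T U : topologicalType) (t : T) :
  continuous (fun y : U => (t, y)).
Proof.
move=> y A [[P Q] /= [Pt Qy] PQ]; apply: filterS Qy => z Qz.
by apply: PQ; split => //=; exact: nbhs_singleton.
Qed.

Lemma itv_partition_interior (a b t : R) (s : seq R) :
  itv_partition a b s -> a <= t <= b -> t \notin a :: s ->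
  exists2 k, (k < size s)%N & nth 0 (a :: s) k < t < nth 0 s k.
Proof.
elim: s a => [|x s IH] a abs /andP[at_ tb].
  have ab := itv_partition_nil abs; rewrite inE => /negP[].
  by rewrite eq_le at_ ab tb.
rewrite inE negb_or => /andP[ta txs].
have xs : t != x by move: txs; rewrite inE negb_or => /andP[].
have [tx|xt] := ltP t x.
  by exists 0%N => //=; rewrite tx andbT lt_neqAle eq_sym ta.
have [] := IH x (itv_partition_cons abs) _ txs; first by rewrite xt.
by move=> k ks kt; exists k.+1.
Qed.

End more_calculus.

(** * Comparison of the quadratic forms at a single metric *)

Section geometry_lemmas.
Context {R : realType} {d : nat} (M : closed_manifold R d).

Lemma metric_posdef (g : field M 'M[R]_d) i y :
  metric g -> img i y -> posdef (g i y).
Proof.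
by move=> [[_ sg _] pg] iy; split; [exact: sg|move=> u u0; exact: pg].
Qed.

Lemma imgP (i : chart M) x : dom i x -> img i (Defs.coord i x).
Proof. by exists x. Qed.

(** In the transformation law [g_i = J g_j J^T] the left side is invertible, hence so is [J]; no
    inverse transition map has to be differentiated. *)
Lemma metric_jac_unitmx (g : field M 'M[R]_d) (i j : chart M) (x : M) :
  metric g -> dom i x -> dom j x -> transition_jac i j x \in unitmx.
Proof.
move=> mg ix jx; have [[_ _ /(_ i j x ix jx) gE] _] := mg.
have := posdef_unitmx (metric_posdef mg (imgP ix)).
by rewrite gE !unitmx_mul => /andP[/andP[]].
Qed.

Lemma density_vol (g : field M 'M[R]_d) : metric g -> density (vol g).
Proof.
move=> mg; have [[sg _ gE] _] := mg; split.
- move=> i k; apply: Ck_sqrt; first exact: open_coord.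
    by move=> y iy; apply: det_posdef; exact: metric_posdef.
  by apply: Ck_det; [exact: open_coord|exact: sg].
- by move=> i y iy; rewrite sqrtr_gt0 det_posdef//; exact: metric_posdef.
- move=> i j x ix jx; rewrite /vol (gE i j x)// !det_mulmx det_tr mulrAC.
  by rewrite -expr2 sqrtrM ?sqr_ge0// sqrtr_sqr.
Qed.

(** The reaction term must be a function on [M], not a family of chart expressions, so a chart is
    chosen at each point; [half_traceE] shows that the choice is immaterial. *)
Definition half_trace (g h : field M 'M[R]_d) (x : M) : R :=
  let i := projT1 (cid (dom_cover x)) in
  let y := Defs.coord i x in \tr (invmx (g i y) *m h i y) / 2.

Lemma half_traceE (g h : field M 'M[R]_d) i y :
  metric g -> sym2_field h -> img i y ->
  half_trace g h (param i y) = \tr (invmx (g i y) *m h i y) / 2.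
Proof.
move=> mg [_ _ hE] [x ix <-]; rewrite coordK// /half_trace.
case: (cid _) => j jx /=; have [[_ _ gE] _] := mg.
rewrite (gE i j x)// (hE i j x)// mxtrace_invmx_congr//.
  exact: (metric_jac_unitmx mg).
by apply: posdef_unitmx; exact: metric_posdef mg (imgP jx).
Qed.

Lemma smooth_half_trace (g h : field M 'M[R]_d) :
  metric g -> sym2_field h -> smooth_function (half_trace g h).
Proof.
move=> mg sh i k; have oi : open (img i) by exact: open_coord.
apply: (@Ck_eq _ _ _ _ _ (fun y => \tr (invmx (g i y) *m h i y) * 2^-1)) => //.
  by move=> y iy; rewrite half_traceE.
apply: CkM => //; last exact: Ck_cst.
apply: Ck_mxtrace => //; apply: Ck_mulmx => //.
  2: by case: sh => + _ _; apply.
apply: Ck_invmx => //; last by case: mg => [[+ _ _] _]; apply.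
by move=> y iy; apply: posdef_unitmx; exact: metric_posdef.
Qed.

Lemma smooth_field_derive (W : normedModType R) (a : field M W) i y c :
  smooth_field a -> img i y ->
  is_derive y (delta_mx 0 c) (a i) (partial c (a i) y).
Proof. by move=> sa iy; exact: Ck_is_derive (sa i 1%N) iy. Qed.

Lemma mxtrace_lie_sym2 (v : field M 'rV[R]_d) (g : field M 'M[R]_d) i y :
  metric g -> img i y ->
  \tr (invmx (g i y) *m lie_sym2 v g i y) =
  \sum_c (v i y 0 c * \tr (invmx (g i y) *m partial c (g i) y)
          + partial c (v i) y 0 c *+ 2).
Proof.
move=> mg iy; have ug := posdef_unitmx (metric_posdef mg iy).
(* [P] is the matrix of partial derivatives of [v]. Multiplied by [g^-1] and traced, [P g] and
   [g P^T] each leave [tr P], the coordinate divergence of [v]: this is the factor 2. *)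
pose P := \matrix_(a, c) partial a (v i) y 0 c.
have -> : lie_sym2 v g i y =
    \sum_c v i y 0 c *: partial c (g i) y + P *m g i y + g i y *m P^T.
  apply/matrixP => a b; rewrite !mxE summxE -!big_split /=.
  apply: eq_bigr => c _; rewrite !mxE; congr (_ + _ + _).
  exact: mulrC.
rewrite !mulmxDr !mxtraceD mulKmx// mxtrace_tr.
rewrite [\tr (_ *m (P *m _))]mxtrace_mulC mulmxK//.
rewrite -addrA -mulr2n big_split /= sumrMnl; congr (_ + _ *+ 2).
  rewrite mulmx_sumr raddf_sum; apply: eq_bigr => c _ /=.
  by rewrite -scalemxAr mxtraceZ.
by apply: eq_bigr => c _; rewrite mxE.
Qed.

(** The infinitesimal form of the naturality of the volume under diffeomorphisms, obtained in
    coordinates from the product rule for [v^c sqrt (det g)] instead of from flows. *)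
Lemma lie_density_vol (v : field M 'rV[R]_d) (g : field M 'M[R]_d) i y :
  vector_field v -> metric g -> img i y ->
  lie_density v (vol g) i y =
  \tr (invmx (g i y) *m lie_sym2 v g i y) / 2 * vol g i y.
Proof.
move=> [sv _] mg iy; have [[sg _ _] _] := mg.
rewrite mxtrace_lie_sym2// mulr_suml mulr_suml; apply: eq_bigr => c _.
have dv := is_derive_coord 0 c (smooth_field_derive c sv iy).
have dg := is_derive_sqrt_det (metric_posdef mg iy)
  (smooth_field_derive c sg iy).
have [_ E] := is_deriveM dv dg; rewrite [LHS]E /vol.
by rewrite /GRing.scale /= -[_ *+ 2]mulr_natr; field.
Qed.

Lemma reaction_cost_le_ebin (g h : field M 'M[R]_d) (Lambda : R) :
  metric g -> sym2_field h -> (0 < d)%N -> 0 <= Lambda ->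
  (Lambda%:E * reaction_cost (half_trace g h) (vol g) <=
   (d%:R * Lambda / 4)%:E * ebin g h h)%E.
Proof.
move=> mg sh d0; rewrite le_eqVlt => /predU1P[<-|L0].
  (* For [Lambda = 0] both sides vanish even if the integrals are infinite, since [0 * +oo = 0];
     afterwards [Lambda] can be cancelled. *)
  by rewrite mulr0 mul0r !mul0e.
have -> : d%:R * Lambda / 4 = Lambda * (d%:R / 4) by rewrite mulrAC mulrC.
rewrite EFinM -muleA lee_pmul2l ?lte_fin//.
have vol0 i y : img i y -> 0 <= vol g i y by move=> _; exact: sqrtr_ge0.
have sh' i y : img i y -> (h i y)^T = h i y by case: sh => _ + _; exact.
apply: le_integral_densityZ.
- by rewrite divr_gt0// ltr0n.
- by move=> i y iy; rewrite mulr_ge0 ?sqr_ge0 ?vol0.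
- move=> i y iy; rewrite mulr_ge0 ?vol0// mxtrace_posdef_ge0//; last exact: sh'.
  exact: metric_posdef.
- move=> i y iy; rewrite half_traceE// mulrA ler_wpM2r ?vol0//.
  have := mxtrace_posdef_sqr (metric_posdef mg iy) (sh' _ _ iy).
  by move: (\tr _) (\tr _) => t q; lra.
Qed.

(** Covers arguments of any sign, [sqrte] being 0 below 0, so that it applies directly to the infima
    defining the metrics. *)
Lemma le_sqrte (x y : \bar R) : (x <= y -> sqrte x <= sqrte y)%E.
Proof.
have [y0|y0] := leP 0%E y; first by rewrite lee_sqrt.
move=> xy; have x0 := le_lt_trans xy y0; case: x x0 {xy} => [r|//|_].
  rewrite lte_fin => r0; have -> : sqrte r%:E = 0%E.
    by rewrite /= ler0_sqrtr// ltW.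
  exact: sqrte_ge0.
exact: sqrte_ge0.
Qed.

Lemma wasserstein_fisher_rao_le (g0 g dg : field M 'M[R]_d) (drho : field M R)
    (Lambda : R) :
  (0 < d)%N -> 0 <= Lambda -> metric g ->
  field_eq drho (fun i y =>
    \tr (invmx (g i y) *m dg i y) / 2 * vol g i y) ->
  (wasserstein_fisher_rao g0 Lambda (vol g) drho <=
   wasserstein_ebin g0 Lambda g dg)%E.
Proof.
move=> d0 L0 mg drhoE; apply: le_ereal_inf_tmp => _ [v [h [vv sh dgE ->]]].
(* Each competitor [(v, h)] yields the competitor [(v, f)] with unchanged transport cost. *)
apply: ge_ereal_inf; exists (transport_cost g0 v (vol g) +
    Lambda%:E * reaction_cost (half_trace g h) (vol g))%E.
  exists v, (half_trace g h); split=> //; first exact: smooth_half_trace.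
  move=> i y iy; rewrite drhoE// dgE// half_traceE// lie_density_vol//.
  by rewrite mulmxDr mulmxN mxtraceD raddfN /= !mulrDl !mulNr.
by rewrite leeD2l// reaction_cost_le_ebin.
Qed.

Lemma wasserstein_ebin_le (g0 g h : field M 'M[R]_d) (Lambda : R) :
  sym2_field h ->
  (wasserstein_ebin g0 Lambda g h <= (d%:R * Lambda / 4)%:E * ebin g h h)%E.
Proof.
move=> sh; apply: ge_ereal_inf.
exists ((d%:R * Lambda / 4)%:E * ebin g h h)%E => //.
exists (fun _ _ => 0), h; split=> //.
- split; last by move=> i j x _ _; rewrite mul0mx.
  by move=> i k; apply: Ck_cst; exact: open_coord.
- move=> i y iy; rewrite [X in - X](_ : _ = 0) ?oppr0 ?add0r//.
  apply/matrixP => a b; rewrite !mxE big1// => c _.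
  by rewrite /partial !derive_cst !mxE !mul0r !addr0.
- rewrite [transport_cost _ _ _](_ : _ = 0%E) ?add0e//.
  rewrite -[RHS](integral_density0 M); congr integral_density.
  by apply/funext => i; apply/funext => y; rewrite !mul0mx mxE mul0r.
Qed.

End geometry_lemmas.

(** * Paths of metrics, their velocities and lengths *)

Section paths.
Context {R : realType} {d : nat} (M : closed_manifold R d).

(** Off the break points the path coincides near [t] with a jointly smooth [F], so its velocity is
    the slice at time [t] of the derivative of [F] in the direction [(1, 0)]. Joint smoothness is
    what makes this slice smooth in space. *)
Lemma regular_time (W : normedModType R) (gamma : R -> field M W) :
  piecewise_smooth gamma ->
  exists N : seq R, forall t : R, t \in `[0, 1] -> t \notin N ->
  [/\ nbhs t [set s | s \in `[0 : R, 1]],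
      forall i y, img i y ->
        is_derive t 1 (fun s => gamma s i y) (velocity gamma t i y) &
      smooth_field (velocity gamma t)].
Proof.
move=> [s [ps sP]]; exists (0 :: s) => t; rewrite in_itv /= => t01 tN.
have [k ks /andP[kt tk]] := itv_partition_interior ps t01 tN.
set a := nth 0 (0 :: s) k in kt; set b := nth 0 s k in tk.
have tab : nbhs t `]a, b[%classic.
  by apply: open_nbhs_nbhs; split; [exact: itv_open|rewrite /= in_itv /= kt].
have ab01 r : a <= r <= b -> 0 <= r <= 1.
  have le0a : 0 <= a.
    have := @itv_partition_nth_ge _ _ 0 1 s k (ltnW ks) ps.
    by rewrite (set_nth_default 0)//= ltnW.
  have leb1 : b <= 1.
    have := @itv_partition_nth_le _ _ 0 1 s k.+1 ks ps.
    by rewrite /= (set_nth_default 0).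
  by move=> /andP[ar rb]; rewrite (le_trans le0a)//= (le_trans rb).
have key i : exists2 F : R * 'rV[R]_d -> W,
    (exists Q, [/\ open Q, `[a, b] `*` img i `<=` Q & smooth_open Q F]) &
    forall y, img i y -> \forall r \near t, F (r, y) = gamma r i y.
  have [Q [F [oO sO sF FE]]] := sP k ks i; exists F; first by exists Q.
  move=> y iy; apply: filterS tab => r /=; rewrite in_itv /= => /andP[ar rb].
  by rewrite (FE (r, y))//; split=> //=; rewrite in_itv /= !ltW.
have tIab : t \in `[a, b] by rewrite in_itv /= !ltW.
have dgm i y F : img i y ->
    (exists Q, [/\ open Q, `[a, b] `*` img i `<=` Q & smooth_open Q F]) ->
    (\forall r \near t, F (r, y) = gamma r i y) ->
    is_derive t 1 (fun s => gamma s i y) ('D_(1, 0) F (t, y)).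
  move=> iy [Q [oO sO sF]] Fg; apply: near_eq_is_derive Fg _.
  apply: (@is_derive_precomp _ _ _ _ (fun r => (r, y)) (fun v => (v, 0))).
    by move=> h z; congr pair; rewrite /= scaler0 add0r.
  by apply: (Ck_is_derive _ (sF 1%N)); exact: sO.
split.
- apply: filterS tab => r /=; rewrite in_itv /= => /andP[ar rb].
  by rewrite in_itv /= ab01// !ltW.
- move=> i y iy; have [F HF Fg] := key i.
  have dg := dgm i y F iy HF (Fg y iy).
  rewrite /velocity derive1E; apply: (is_derive_eq dg).
  by rewrite (@derive_val _ _ _ _ _ _ _ dg).
- move=> i n; have [F HF Fg] := key i.
  have oi : open (img i) by exact: open_coord.
  apply: (@Ck_eq _ _ _ _ _ (fun y => 'D_(1, 0) F (t, y))) => //.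
    move=> y iy; rewrite /velocity derive1E.
    by rewrite (@derive_val _ _ _ _ _ _ _ (dgm i y F iy HF (Fg y iy))).
  have [Q [oO sO sF]] := HF.
  apply: (@Ck_precomp _ _ _ _ (fun y => (t, y)) (fun v => (0, v)) n Q (img i)
    ('D_(1, 0) F)) => //.
  + exact: continuous_pairl.
  + by move=> h v y; congr pair; rewrite /= scaler0 add0r.
  + by move=> y iy; apply: sO.
  + exact: Ck_derive (sF n.+1).
Qed.

(** Symmetry and the transformation law are linear identities valid at all times near [t], so they
    survive differentiation. This makes the velocity an admissible [h] in the upper bound. *)
Lemma sym2_field_velocity (gamma : R -> field M 'M[R]_d) t :
  nbhs t [set s | metric (gamma s)] ->
  (forall i y, img i y ->
     is_derive t 1 (fun s => gamma s i y) (velocity gamma t i y)) ->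
  smooth_field (velocity gamma t) -> sym2_field (velocity gamma t).
Proof.
move=> mg dg sv; split=> // [i y iy|i j x ix jx].
  apply: (is_derive_unique _ (dg i y iy)).
  have := is_derive_linear (@linearP _ _ _ _ (@trmx R d d))
    (linear_matrix_continuous (@linearP _ _ _ _ (@trmx R d d))) (dg i y iy).
  apply: near_eq_is_derive; apply: filterS mg => s [[_ sg _] _].
  exact: sg.
set J := transition_jac i j x.
have linJ : linear (fun A : 'M[R]_d => J *m A *m J^T).
  by move=> a A B; rewrite mulmxDr mulmxDl -scalemxAr -scalemxAl.
apply: (is_derive_unique (dg i _ (imgP ix))).
have := is_derive_linear linJ (linear_matrix_continuous linJ)
  (dg j _ (imgP jx)).
apply: near_eq_is_derive; apply: filterS mg => s [[_ _ gE] _].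
by rewrite (gE i j x).
Qed.

Lemma path_in_vol (g1 g2 : field M 'M[R]_d) (gamma : R -> field M 'M[R]_d) :
  path_in (@metric R d M) g1 g2 gamma ->
  path_in (@density R d M) (vol g1) (vol g2) (fun t => vol (gamma t)).
Proof.
move=> [[s [ps sP]] mg g1E g2E]; split.
- exists s; split=> // k ks i; have [Q [F [oO sO sF FE]]] := sP k ks i.
  (* Outside the original piece the extension [F] need not take positive definite values, so its
     domain is shrunk to where the root of the determinant is smooth. *)
  have oO' : open (Q `&` [set p | 0 < \det (F p)]).
    apply: open_pos_preimage => // p Op.
    exact: Ck_continuous (Ck_det oO (sF 0%N)) Op.
  exists (Q `&` [set p | 0 < \det (F p)]), (fun p => Num.sqrt (\det (F p))).
  split=> //.
  + move=> p pi; split; first exact: sO.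
    rewrite /= -FE//; case: pi => p1 p2; apply: det_posdef.
    apply: metric_posdef p2; apply: mg.
    move: p1; rewrite /= !in_itv /= => /andP[kp pk].
    have := @itv_partition_nth_ge _ _ 0 1 s k (ltnW ks) ps.
    have := @itv_partition_nth_le _ _ 0 1 s k.+1 ks ps.
    rewrite /= (set_nth_default 0)// => s1.
    rewrite (set_nth_default 0)//= 1?ltnW// => s0.
    by rewrite (le_trans s0)//= (le_trans pk).
  + move=> n; apply: Ck_sqrt => //; first by move=> p [].
    apply: Ck_det => //; apply: Ck_subset (sF n); exact: subIsetl.
  + by move=> p pi; rewrite /vol FE.
- by move=> t /mg; exact: density_vol.
- by move=> i y iy; rewrite /vol g1E.
- by move=> i y iy; rewrite /vol g2E.
Qed.

Lemma metric_convex (g1 g2 : field M 'M[R]_d) t :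
  metric g1 -> metric g2 -> t \in `[0, 1] ->
  metric (fun i y => (1 - t) *: g1 i y + t *: g2 i y).
Proof.
move=> [[s1 t1 e1] p1] [[s2 t2 e2] p2]; rewrite in_itv /= => /andP[t0 tl1].
split; [split|].
- move=> i n; have oi : open (img i) by exact: open_coord.
  have CZ (c : R) (g : field M 'M[R]_d) : smooth_field g ->
      Ck n (img i) (fun y => c *: g i y).
    move=> sg; apply: (@Ck_linear _ _ _ _ (fun A : 'M[R]_d => c *: A)) => //.
      by move=> a A B; rewrite scalerDr !scalerA mulrC.
      exact: scaler_continuous.
    exact: sg.
  by apply: CkD => //; exact: CZ.
- by move=> i y iy; rewrite linearD !linearZ /= t1// t2.
- move=> i j x ix jx; rewrite (e1 i j x)// (e2 i j x)//.
  by rewrite mulmxDr mulmxDl -!scalemxAr -!scalemxAl.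
- move=> i y u iy u0; rewrite mulmxDr mulmxDl -!scalemxAr -!scalemxAl.
  rewrite mxE [X in X + _]mxE [X in _ + X]mxE.
  have q1 := p1 i y u iy u0; have q2 := p2 i y u iy u0.
  move: (_ 0 0) (_ 0 0) q1 q2 => q1 q2 q10 q20.
  have [->|tn1] := eqVneq t 1; first by rewrite subrr mul0r add0r mul1r.
  rewrite ltr_pwDl ?mulr_ge0 ?(ltW q20)// mulr_gt0// subr_gt0.
  by rewrite lt_neqAle tn1.
Qed.

Lemma path_in_segment (g1 g2 : field M 'M[R]_d) :
  metric g1 -> metric g2 ->
  path_in (@metric R d M) g1 g2 (fun t i y => (1 - t) *: g1 i y + t *: g2 i y).
Proof.
move=> m1 m2; split.
- exists [:: 1]; split; first by apply: itv_partition1; exact: ltr01.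
  case=> [_|//] i; have oi : open (img i) by exact: open_coord.
  pose Q : set (R * 'rV[R]_d) := snd @^-1` img i.
  have oO : open Q by apply: open_comp => // p _; exact: cvg_snd.
  exists Q, (fun p => (1 - p.1) *: g1 i p.2 + p.1 *: g2 i p.2).
  split=> //; first by move=> p [_ p2].
  move=> n; apply: Ck_matrix => // a b.
  have C1 : Ck n Q (fun p : R * 'rV[R]_d => p.1).
    apply: (@Ck_linear _ _ _ _ (fun p : R * 'rV[R]_d => p.1)) => //.
      by move=> p; exact: cvg_fst.
    exact: Ck_id.
  have C2 (g : field M 'M[R]_d) : metric g -> Ck n Q (fun p => g i p.2 a b).
    move=> [[sg _ _] _]; apply: Ck_coord => //.
    apply: (@Ck_precomp _ _ _ _ snd snd n (img i) Q (fun y => g i y)) => //.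
    + by move=> p; exact: cvg_snd.
    + exact: sg.
  rewrite (_ : (fun p => _) =
    fun p => (1 + (-1) * p.1) * g1 i p.2 a b + p.1 * g2 i p.2 a b).
    apply: CkD => //; apply: CkM => //; [|exact: C2..].
    apply: CkD => //; first exact: Ck_cst.
    by apply: CkM => //; exact: Ck_cst.
  by apply/funext => p; rewrite !mxE mulN1r.
- by move=> t t01; exact: metric_convex.
- by move=> i y iy; rewrite subr0 scale1r scale0r addr0.
- by move=> i y iy; rewrite subrr scale1r scale0r add0r.
Qed.

(** The two paths may live in different spaces, as metrics and densities do. The finite list [N] is
    a Lebesgue null set and absorbs the break points. *)
Lemma le_path_lengthZ (W W' : normedModType R)
    (G : field M W -> field M W -> \bar R)
    (G' : field M W' -> field M W' -> \bar R) gamma gamma' (c : R) (N : seq R) :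
  0 < c ->
  (forall t, t \in `[0, 1] -> t \notin N ->
    (sqrte (G (gamma t) (velocity gamma t)) <=
     c%:E * sqrte (G' (gamma' t) (velocity gamma' t)))%E) ->
  (path_length G gamma <= c%:E * path_length G' gamma')%E.
Proof.
move=> c0 GG'.
have cN : countable [set` N] by apply: finite_set_countable; exact: finite_seq.
rewrite /path_length.
apply: (@ge0_le_integralZ_null R _ _ lebesgue_measure _ [set` N]) => //.
- by apply: countable_measurable => // x; exact: measurable_set1.
- exact: countable_lebesgue_measure0.
- by move=> t _; exact: sqrte_ge0.
- by move=> t _; exact: sqrte_ge0.
- by move=> t t01 /negP tN; exact: GG'.
Qed.

End paths.

(** * The two inequalities between distances *)

Section distances.
Context {R : realType} {d : nat} (M : closed_manifold R d).

Lemma dist_WFR_le_WE (g0 g1 g2 : field M 'M[R]_d) (Lambda : R) :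
  (0 < d)%N -> 0 <= Lambda ->
  (dist_WFR g0 Lambda (vol g1) (vol g2) <= dist_WE g0 Lambda g1 g2)%E.
Proof.
move=> d0 L0; apply: le_ereal_inf_tmp => _ [gamma pg <-]; apply: ge_ereal_inf.
exists (path_length (wasserstein_fisher_rao g0 Lambda)
  (fun t => vol (gamma t))).
  by exists (fun t => vol (gamma t)) => //; exact: path_in_vol pg.
have [/regular_time [N HN] mg _ _] := pg.
rewrite -[leRHS]mul1e; apply: (@le_path_lengthZ _ _ _ _ _ _ _ _ _ 1 N) => //.
move=> t t01 tN; have [_ dg _] := HN t t01 tN.
rewrite mul1e; apply: le_sqrte; apply: wasserstein_fisher_rao_le => //.
  exact: mg.
move=> i y iy; rewrite /velocity derive1E.
have := is_derive_sqrt_det (metric_posdef (mg t t01) iy) (dg i y iy).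
by case.
Qed.

Lemma sym2_field_velocity_path (g1 g2 : field M 'M[R]_d) gamma :
  path_in (@metric R d M) g1 g2 gamma ->
  exists N : seq R, forall t : R, t \in `[0, 1] -> t \notin N ->
    sym2_field (velocity gamma t).
Proof.
move=> [/regular_time [N HN] mg _ _]; exists N => t t01 tN.
have [n01 dg sg] := HN t t01 tN; apply: sym2_field_velocity => //.
by apply: filterS n01 => s; exact: mg.
Qed.

Lemma dist_WE_le_E (g0 g1 g2 : field M 'M[R]_d) (Lambda : R) :
  (0 < d)%N -> 0 <= Lambda -> metric g1 -> metric g2 ->
  (dist_WE g0 Lambda g1 g2
     <= (Num.sqrt (d%:R * Lambda) / 2)%:E * dist_E g1 g2)%E.
Proof.
move=> d0 L0 m1 m2; have dR : 0 < d%:R :> R by rewrite ltr0n.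
set c := Num.sqrt _ / 2.
(* The weight of the Ebin term is the square of the constant, which [sqrte] turns into the factor
   [c] of the lengths. *)
have c2 : d%:R * Lambda / 4 = c ^+ 2.
  rewrite expr_div_n sqr_sqrtr ?mulr_ge0// ?ltW//.
  by rewrite -natrX.
move: L0; rewrite le_eqVlt => /predU1P[LE|Lpos].
  (* [dist_E g1 g2] could be [+oo], but [0 * +oo = 0]: some path has to be
     exhibited, here the straight segment. *)
  have -> : c = 0 by rewrite /c -LE mulr0 sqrtr0 mul0r.
  rewrite mul0e; apply: ge_ereal_inf.
  pose gamma (t : R) : field M 'M[R]_d :=
    fun i y => (1 - t) *: g1 i y + t *: g2 i y.
  have pg : path_in (@metric R d M) g1 g2 gamma by exact: path_in_segment.
  have [N HN] := sym2_field_velocity_path pg.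
  exists (path_length (wasserstein_ebin g0 Lambda) gamma).
    by exists gamma.
  (* Zero is written as the length for the zero form, so that [le_path_lengthZ] applies although
     [c = 0]. *)
  have <- : (1%:E * path_length (fun _ _ : field M 'M[R]_d => 0%E) gamma = 0)%E.
    rewrite mul1e /path_length (eq_integral (cst 0%E)) ?integral0// => t _.
    by rewrite sqrte0.
  apply: (le_path_lengthZ (N := N)) => // t t01 tN.
  rewrite mul1e; apply: le_sqrte.
  apply: le_trans (wasserstein_ebin_le _ _ _ (HN t t01 tN)) _.
  by rewrite -LE mulr0 mul0r mul0e.
have c0 : 0 < c by rewrite divr_gt0// sqrtr_gt0 mulr_gt0.
(* Division by [c] isolates the infimum over paths on the right, so that a single path [gamma] can
   be fixed; the factor is then moved back. *)
rewrite -lee_pdivrMl//; apply: le_ereal_inf_tmp => _ [gamma pg <-].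
rewrite lee_pdivrMl//; apply: ge_ereal_inf.
exists (path_length (wasserstein_ebin g0 Lambda) gamma); first by exists gamma.
have [N HN] := sym2_field_velocity_path pg; have [_ mg _ _] := pg.
apply: (le_path_lengthZ (N := N)) => // t t01 tN.
have sv := HN t t01 tN.
apply: le_trans (le_sqrte (wasserstein_ebin_le _ _ _ sv)) _.
rewrite c2 sqrteM ?lee_fin ?sqr_ge0// EFin_expe sqrte_sqr gee0_abs//.
by rewrite lee_fin ltW.
Qed.

End distances.

Theorem lemma5p13 (R : realType) (d : nat) (M : closed_manifold R d)
    (g0 : field M 'M[R]_d) (Lambda : R) (g1 g2 : field M 'M[R]_d) :
  (0 < d)%N -> metric g0 -> 0 <= Lambda -> metric g1 -> metric g2 ->
  (dist_WFR g0 Lambda (vol g1) (vol g2) <= dist_WE g0 Lambda g1 g2)%E /\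
  (dist_WE g0 Lambda g1 g2
     <= (Num.sqrt (d%:R * Lambda) / 2)%:E * dist_E g1 g2)%E.
Proof.
move=> d0 _ L0 m1 m2; split; first exact: dist_WFR_le_WE.
exact: dist_WE_le_E.
Qed.
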